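(* Let $(X,d)$ be a locally connected compact metric space and $f_{0,\infty}=\{f_n\}_{n=0}^\infty$ a sequence of continuous self-maps of $X$ with $f_0$ surjective. If $(X,f_{0,\infty})$ is multi-sensitive, then there exists $A\in\mathcal{S}$ such that $h_{A}(f_{0,\infty})=+\infty$, and $h_{A}(\hat f_{0,\infty})=h^{*}(\hat f_{0,\infty})=h^{*}(f_{0,\infty})=+\infty$.
   Context: $f_0^n=f_{n-1}\circ\cdots\circ f_0$, $f_0^0=\mathrm{id}$. $(X,f_{0,\infty})$ is multi-sensitive if there is $\delta>0$ such that for every $k\ge1$ and nonempty open $V_1,\dots,V_k\subset X$ there is $n\ge1$ with $\mathrm{diam}(f_0^n(V_i))>\delta$ for all $1\le i\le k$. $\mathcal S$ is the set of strictly increasing sequences $A=\{a_i\}_{i\ge1}$ of nonnegative integers. For a compact metric space $Z$ and continuous self-maps $g_{0,\infty}$, $h_A(g_{0,\infty})=\sup_{\mathscr A}\limsup_{n\to\infty}\frac1n\log\mathcal N(\bigvee_{i=1}^n (g_0^{a_i})^{-1}\mathscr A)$ over finite open covers ($\bigvee$ = common refinement, $\mathcal N$ = minimal cardinality of a subcover), and $h^*(g_{0,\infty})=\sup_{A\in\mathcal S}h_A(g_{0,\infty})$. $\mathcal M(X)$ is the space of Borel probability measures with the weak$^*$ topology (compact metric, e.g. via the Prohorov metric), and $\hat f_n(\mu)(B)=\mu(f_n^{-1}(B))$. *)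

(* Defs.v *)
From HB Require Import structures.
From mathcomp Require Import all_boot all_order all_algebra.
From mathcomp Require Import all_classical all_reals all_analysis.

Set Implicit Arguments.
Unset Strict Implicit.
Unset Printing Implicit Defensive.

Import Order.TTheory GRing.Theory Num.Theory.
Import numFieldTopology.Exports numFieldNormedType.Exports.
Local Open Scope classical_set_scope.
Local Open Scope ring_scope.

#[short(type="pmetricType")]
HB.structure Definition PointedMetric (K : numDomainType) :=
  { M of Pointed M & Metric K M }.

Fixpoint compn {Z : Type} (g : nat -> Z -> Z) (n : nat) : Z -> Z :=
  match n with
  | 0 => id
  | n'.+1 => g n' \o compn g n'
  end.

Section metric_defs.
Context {R : realType} (X : pmetricType R).

Definition diam (A : set X) : \bar R :=
  ereal_sup [set (mdist x y)%:E | x in A & y in A].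

Definition locally_connected : Prop :=
  forall (x : X) (U : set X), open U -> U x ->
    exists V : set X, [/\ open V, connected V, V x & V `<=` U].

Definition multi_sensitive (f : nat -> X -> X) : Prop :=
  exists delta : R, 0 < delta /\
    forall (k : nat) (V : 'I_k -> set X), (0 < k)%N ->
      (forall i, open (V i) /\ V i !=set0) ->
      exists n : nat, (1 <= n)%N /\
        forall i, (delta%:E < diam (compn f n @` V i))%E.
End metric_defs.

(* ---------- sequence entropy of g_{0,oo} on a space Z whose open sets are
   given by the family [op] ---------- *)
Section seq_entropy.
Context {R : realType} {Z : Type} (op : set (set Z)).

Definition finite_open_cover (U : set (set Z)) : Prop :=
  [/\ finite_set U, U `<=` op & \bigcup_(A in U) A = [set: Z]].

Definition preimg_family (g : Z -> Z) (U : set (set Z)) : set (set Z) :=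
  [set g @^-1` A | A in U].

Definition join_family (U V : set (set Z)) : set (set Z) :=
  [set A `&` B | A in U & B in V].

Fixpoint joinN (F : nat -> set (set Z)) (n : nat) : set (set Z) :=
  match n with
  | 0 => [set [set: Z]]
  | n'.+1 => join_family (joinN F n') (F n')
  end.

Definition subcover_sizes (W : set (set Z)) : set nat :=
  [set n | exists F : 'I_n -> set Z,
             (forall i, W (F i)) /\ (forall z, exists i, F i z)].

Definition covN (W : set (set Z)) : R :=
  inf [set (n%:R : R) | n in subcover_sizes W].

(* A = {a_i}_{i>=1} is encoded as a : nat -> nat, a j = a_{j+1} *)
Definition strictly_increasing (a : nat -> nat) : Prop :=
  forall i, (a i < a i.+1)%N.

Definition seq_entropy_along (g : nat -> Z -> Z) (a : nat -> nat) : \bar R :=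
  ereal_sup [set limn_esup (fun n : nat =>
      ((ln (covN (joinN (fun i => preimg_family (compn g (a i)) U) n)))
        / n%:R)%:E)
    | U in finite_open_cover].

Definition seq_entropy (g : nat -> Z -> Z) : \bar R :=
  ereal_sup [set seq_entropy_along g a | a in strictly_increasing].
End seq_entropy.

Section measures.
Context {R : realType} (X : pmetricType R).

Definition Borel := g_sigma_algebraType (@open X).

Definition probM := probability Borel R.

Definition weak_open (U : set probM) : Prop :=
  forall mu : probM, U mu ->
    exists (k : nat) (g : 'I_k -> X -> R) (e : R),
      [/\ forall i, continuous (g i), 0 < e &
          [set nu : probM | forall i,
              `| Rintegral nu setT (fun x : Borel => g i x)
                 - Rintegral mu setT (fun x : Borel => g i x) | < e] `<=` U].

(* induced map  \hat f (mu) = mu o f^{-1}  (f is Borel measurable when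
   continuous; the fallback branch is never used for continuous f) *)
Definition hatmap (f : X -> X) (mu : probM) : probM :=
  match pselect (measurable_fun [set: Borel] (f : Borel -> Borel)) with
  | left mf =>
      Probability.clone _ _ R (distribution mu (mfun_Sub (mem_set mf) : {mfun Borel >-> Borel})) _
  | right _ => mu
  end.

Definition hatseq (f : nat -> X -> X) : nat -> probM -> probM :=
  fun n => hatmap (f n).
End measures.

(* Main.v *)
(* The image of a connected set of diameter > e meets all spheres of radius < e
   about one of its points.  Multi-sensitivity moves finitely many connected
   open sets to diameter > e at a common time, which can be taken late by first
   shrinking the sets; local connectivity then yields, inside each of them,
   connected open subsets landing in pairwise separated rings.  Iterating, with
   k+1 branches at the k-th time a_k, gives for every M, from stage M on, an
   M-ary tree of points separated along a at a scale depending only on M, so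
   the entropy along a is at least (log M)/2 for every M.
   For measures the same tree of Dirac masses is separated by the weakly open
   sets {mu : int phi_p dmu > 0}, phi_p bump functions whose supports are small
   balls covering X; finitely many of them cover all probability measures, so
   compactness of the space of measures is not needed. *)
Require Import Defs.
From HB Require Import structures.
From mathcomp Require Import all_boot all_order all_algebra.
From mathcomp Require Import all_classical all_reals all_analysis.
From mathcomp Require Import finmap zify ring lra.
Set Implicit Arguments.
Unset Strict Implicit.
Unset Printing Implicit Defensive.
Import numFieldTopology.Exports numFieldNormedType.Exports.
Import Order.TTheory GRing.Theory Num.Theory.
Local Open Scope classical_set_scope.
Local Open Scope ereal_scope.

Local Open Scope ring_scope.

(** * Continuity of the distance and of the orbit maps *)

Lemma continuous_mdist (R : realType) (X : pmetricType R) (p : X) :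
  continuous (fun x : X => mdist p x).
Proof.
move=> x; apply/cvgrPdist_lt => e e0; near=> y.
have xy : mdist x y < e.
  by near: y; exact: (metricType_numDomainType.cvgr_dist_lt cvg_id e0).
have := metric_triangle p x y; have := metric_triangle p y x.
by rewrite (metric_sym y x) => h1 h2; rewrite ltr_distl; apply/andP; split; lra.
Unshelve. all: by end_near. Qed.

Lemma continuous_compn (T : topologicalType) (f : nat -> T -> T) (n : nat) :
  (forall k, continuous (f k)) -> continuous (compn f n).
Proof.
move=> cf; elim: n => [|n IH] x /=; first exact: cvg_id.
by apply: continuous_comp; [exact: IH|exact: cf].
Qed.

(** Near one point the finitely many continuous maps [compn f j], [j <= N], move less than [e / 2].
    This serves to delay sensitivity: the images of [W] cannot exceed diameter [e] before time
    [N.+1]. *)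
Lemma open_shrink_diam (R : realType) (X : pmetricType R) (f : nat -> X -> X)
    (e : R) (N : nat) (V : set X) :
  (forall k, continuous (f k)) -> 0 < e -> open V -> V !=set0 ->
  exists W : set X, [/\ open W, W !=set0, W `<=` V &
    forall j, (j <= N)%N -> (diam (compn f j @` W) <= e%:E)%E].
Proof.
move=> cf e0 oV [x Vx].
have e20 : 0 < e / 2 by rewrite divr_gt0.
have : nbhs x (V `&` [set y | forall j : 'I_N.+1,
    mdist (compn f j x) (compn f j y) < e / 2]).
  apply: filterI; first exact: open_nbhs_nbhs.
  apply: filter_forall => j.
  by apply: metricType_numDomainType.cvgr_dist_lt e20;
     exact: continuous_compn.
rewrite nbhsE => -[W [oW Wx] WV]; exists W; split => //.
- by exists x.
- by move=> y /WV[].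
move=> j jN; apply: ge_ereal_sup => _ /= [_ [y Wy <-]] [_ [z Wz <-]] <-.
rewrite lee_fin.
have [_ /(_ (Ordinal (jN : (j < N.+1)%N)))/= hy] := WV _ Wy.
have [_ /(_ (Ordinal (jN : (j < N.+1)%N)))/= hz] := WV _ Wz.
have := metric_triangle (compn f j y) (compn f j x) (compn f j z).
rewrite (metric_sym (compn f j y) (compn f j x)); lra.
Qed.

(** * Connected open sets and rings met by their images *)

Definition open_connected (T : topologicalType) (V : set T) : Prop :=
  [/\ open V, connected V & V !=set0].

(* For [c <> c'] these rings are at positive distance, and they do not shrink
   along the construction: this keeps every scale available at all late times. *)
Definition ring_around (R : realType) (X : pmetricType R) (e : R) (p : X)
    (c : nat) : set X :=
  [set y | e / (c.*2.+2)%:R < mdist p y /\ mdist p y < e / (c.*2.+1)%:R].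

Lemma ring_around_open (R : realType) (X : pmetricType R) (e : R) (p : X)
    (c : nat) : open (ring_around e p c).
Proof.
have -> : ring_around e p c = mdist p @^-1` (`]e / (c.*2.+2)%:R, e / (c.*2.+1)%:R[).
  by apply/seteqP; split => y /=; rewrite in_itv /= => /andP.
by apply: open_comp; [move=> y _; exact: continuous_mdist|exact: interval_open].
Qed.

(** For [c < c'] the gap is at least e/(2c+2) - e/(2c+3) = e/((2c+2)(2c+3)), and [c.+2 <= M] bounds
    this below by e/(2M)^2. *)
Lemma ring_around_separated (R : realType) (X : pmetricType R) (e : R) (p : X)
    (M c c' : nat) (y y' : X) :
  0 < e -> (c < M)%N -> (c' < M)%N -> c != c' ->
  ring_around e p c y -> ring_around e p c' y' ->
  e / ((M.*2) ^ 2)%:R <= mdist y y'.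
Proof.
move=> e0; wlog cc' : c c' y y' / (c < c')%N.
  move=> H cM c'M; rewrite neq_lt => /orP[cc'|cc'] h h'.
    by apply: (H c c') => //; rewrite neq_lt cc'.
  by rewrite metric_sym; apply: (H c' c) => //; rewrite neq_lt cc'.
move=> _ c'M _ [h _] [_ h'].
have := metric_triangle p y' y; rewrite (metric_sym y' y) => tri.
have a0 : 0 < (c.*2.+2)%:R :> R by rewrite ltr0n.
have b0 : 0 < (c.*2.+3)%:R :> R by rewrite ltr0n.
have M0 : 0 < (M.*2)%:R :> R by rewrite ltr0n; lia.
have h1 : e / (c'.*2.+1)%:R <= e / (c.*2.+3)%:R.
  rewrite ler_pM2l// lef_pV2 ?posrE ?ltr0n// ler_nat; lia.
have h2 : e / ((M.*2) ^ 2)%:R <= e / (c.*2.+2)%:R - e / (c.*2.+3)%:R.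
  have -> : e / (c.*2.+2)%:R - e / (c.*2.+3)%:R
            = e / ((c.*2.+2)%:R * (c.*2.+3)%:R).
    have -> : (c.*2.+3)%:R = (c.*2.+2)%:R + 1 :> R by rewrite -natr1.
    move: a0; set u := (c.*2.+2)%:R => u0.
    by field; rewrite !gt_eqF//; lra.
  rewrite ler_pM2l// -natrM lef_pV2 ?posrE ?ltr0n ?muln_gt0 ?expn_gt0//; last lia.
  rewrite ler_nat; nia.
apply: le_trans h2 _; rewrite lerBlDr.
apply: le_trans (ltW h) _; apply: le_trans tri _.
by rewrite addrC lerD2l ltW// (lt_le_trans h').
Qed.

(** On the connected [V] the distance to [g x] takes the value 0 and a value above [e], hence all
    values between, so every ring about [g x] is met. Local connectivity at a point landing in the
    ring gives [V']. The centre is fixed before [c]. *)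
Lemma domain_subring (R : realType) (X : pmetricType R) (g : X -> X) (e : R)
    (V : set X) :
  locally_connected X -> continuous g -> 0 < e -> open_connected V ->
  (e%:E < diam (g @` V))%E ->
  exists p : X, forall c : nat, exists V' : set X,
    [/\ open_connected V', V' `<=` V & V' `<=` g @^-1` ring_around e p c].
Proof.
move=> lcX cg e0 [oV cV V0] /ereal_sup_gt[_ [_ [x Vx <-]] [_ [y Vy <-]] <-].
rewrite lte_fin => exy; exists (g x) => c.
have ch : continuous (mdist (g x) \o g).
  by move=> z; apply: continuous_comp; [exact: cg|exact: continuous_mdist].
have /connected_intervalP intI : connected ((mdist (g x) \o g) @` V).
  by apply: connected_continuous_connected => //; exact: continuous_subspaceT.
have lo : 0 < e / (c.*2.+2)%:R by rewrite divr_gt0// ltr0n.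
have mid : e / (c.*2.+2)%:R < e / (c.*2.+1)%:R.
  by rewrite ltr_pM2l// ltf_pV2 ?posrE ?ltr0n// ltr_nat.
have hi : e / (c.*2.+1)%:R <= e.
  by rewrite ler_pdivrMr ?ltr0n// ler_peMr ?ler1n// ltW.
have [r [lor rhi]] : exists r, e / (c.*2.+2)%:R < r /\ r < e / (c.*2.+1)%:R.
  by exists ((e / (c.*2.+2)%:R + e / (c.*2.+1)%:R) / 2); rewrite !midf_lt.
have [z Vz hz] : ((mdist (g x) \o g) @` V) r.
  apply: (intI 0 (mdist (g x) (g y))).
  - by exists x => //=; rewrite mdistxx.
  - by exists y.
  - by rewrite (ltW (lt_trans lo lor)) (ltW (lt_trans (lt_le_trans rhi hi) exy)).
have oU : open (V `&` g @^-1` ring_around e (g x) c).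
  apply: openI => //; apply: open_comp; last exact: ring_around_open.
  by move=> ? _; exact: cg.
have Uz : (V `&` g @^-1` ring_around e (g x) c) z.
  by split => //; rewrite /ring_around /=; move: hz => /= ->.
have [V' [oV' cV' V'z sV']] := lcX _ _ oU Uz.
exists V'; split; first by split => //; exists z.
- by move=> ? /sV'[].
- by move=> ? /sV'[].
Qed.

(** * The tree of connected open sets and its separated points *)

(** One centre serves all [n] children of [V], so distinct children land in separated rings at time
    [a]. Lists keep every level finite, as multi-sensitivity demands. *)
Definition branches (R : realType) (X : pmetricType R) (f : nat -> X -> X)
    (e : R) (n a : nat) (s s' : seq (set X)) : Prop :=
  forall V, V \in s -> exists p : X, forall c, (c < n)%N ->
    exists2 V', V' \in s' &
      V' `<=` V /\ V' `<=` compn f a @^-1` ring_around e p c.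

Lemma branches_exist (R : realType) (X : pmetricType R) (f : nat -> X -> X)
    (e : R) (n N : nat) (s : seq (set X)) :
  locally_connected X -> (forall k, continuous (f k)) -> 0 < e ->
  (forall (k : nat) (V : 'I_k -> set X), (0 < k)%N ->
      (forall i, open (V i) /\ V i !=set0) ->
      exists n : nat, (1 <= n)%N /\
        forall i, (e%:E < diam (compn f n @` V i))%E) ->
  (forall V, V \in s -> open_connected V) ->
  exists a s', [/\ (N < a)%N, forall V, V \in s' -> open_connected V &
    branches f e n a s s'].
Proof.
move=> lcX cf e0 sens gs.
(* Sensitivity speaks of a positive number of sets only; an empty list branches vacuously. *)
have [->|s0] := eqVneq s [::].
  by exists N.+1, [::]; split => // V; rewrite inE.
have size_s : (0 < size s)%N by rewrite lt0n size_eq0.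
(* The shrunken sets only force a late time; the children are sought in [V], as [W V] need not be
   connected. *)
have /choice[W HW] : forall V, exists W : set X, V \in s ->
    [/\ open W, W !=set0, W `<=` V &
      forall j, (j <= N)%N -> (diam (compn f j @` W) <= e%:E)%E].
  move=> V; have [Vs|] := boolP (V \in s); last by exists set0.
  have [oV _ V0] := gs _ Vs.
  by have [W HW] := open_shrink_diam N cf e0 oV V0; exists W.
have [|a [_ Ha]] := sens _ (fun i : 'I_(size s) => W (nth set0 s i)) size_s.
  by move=> i; have [] := HW _ (mem_nth set0 (ltn_ord i)).
have HaW V : V \in s -> (e%:E < diam (compn f a @` W V))%E.
  move=> Vs; have := Ha (Ordinal (etrans (index_mem _ _) Vs)).
  by rewrite /= nth_index.
have Na : (N < a)%N.
  rewrite ltnNge; apply/negP => aN.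
  have s0s : nth set0 s 0 \in s by exact: mem_nth.
  have [_ _ _ /(_ _ aN)] := HW _ s0s.
  by rewrite leNgt HaW.
have /choice[p /choice[ch Hch]] : forall V, exists p : X, exists ch : nat -> set X,
    V \in s -> forall c, [/\ open_connected (ch c), ch c `<=` V &
      ch c `<=` compn f a @^-1` ring_around e p c].
  move=> V; have [Vs|] := boolP (V \in s); last first.
    by exists point, (fun=> set0).
  have [||p] := @domain_subring _ _ (compn f a) e V lcX _ e0 (gs _ Vs).
  - exact: continuous_compn.
  - have [_ _ WV _] := HW _ Vs; apply: lt_le_trans (HaW _ Vs) _.
    apply: ereal_sup_le => _ [_ [x Wx <-]] [_ [y Wy <-]] <-.
    by exists (compn f a x); [exists x => //; exact: WV|
       exists (compn f a y) => //; exists y => //; exact: WV].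
  - by move=> /choice[ch Hch]; exists p, ch.
exists a, [seq ch V c | V <- s, c <- iota 0 n]; split => //.
- by move=> _ /allpairsP[[V c] /= [Vs _ ->]]; have [] := Hch _ Vs c.
- move=> V Vs; exists (p V) => c cn; exists (ch V c).
    by apply: allpairs_f => //; rewrite mem_iota.
  by have [] := Hch _ Vs c.
Qed.

Lemma branching_sequence (R : realType) (X : pmetricType R)
    (f : nat -> X -> X) :
  locally_connected X -> (forall k, continuous (f k)) -> multi_sensitive f ->
  exists (e : R) (a : nat -> nat) (s : nat -> seq (set X)),
    [/\ 0 < e, strictly_increasing a,
        forall k, exists V, V \in s k,
        forall k V, V \in s k -> V !=set0 &
        forall k, branches f e k.+1 (a k) (s k) (s k.+1)].
Proof.
move=> lcX cf [e [e0 sens]].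
pose good (st : nat * seq (set X)) := forall V, V \in st.2 -> open_connected V.
have /choice[F HF] : forall nst : nat * (nat * seq (set X)),
    exists st' : nat * seq (set X), good nst.2 ->
      [/\ (nst.2.1 < st'.1)%N, good st' &
          branches f e nst.1.+1 st'.1 nst.2.2 st'.2].
  move=> [n [N s]]; have [gs|] := pselect (good (N, s)); last by exists (N, s).
  have [a [s' H]] := branches_exist n.+1 N lcX cf e0 sens gs.
  by exists (a, s').
have [V0 [oV0 cV0 V0p _]] := lcX point setT openT I.
pose st := fix st n := if n is n'.+1 then F (n', st n') else (0%N, [:: V0]).
have gst n : good (st n).
  elim: n => [V|n IH] /=; last by have [] := HF (n, st n) IH.
  by rewrite inE => /eqP ->; split => //; exists point.
have Hst n := HF (n, st n) (gst n).
(* [st n.+1] stores the time at which level [n] branches, whence the shift for times but not for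
   lists. The initial 0 is only a lower bound for the first time. *)
exists e, (fun n => (st n.+1).1), (fun n => (st n).2); split => //.
- by move=> n; have [] := Hst n.+1.
- elim=> [|n [V Vn]]; first by exists V0; rewrite inE.
  have [_ _ /(_ V Vn)[p /(_ 0%N isT)[V' V's _]]] := Hst n.
  by exists V'.
- by move=> k V /gst[].
- by move=> n; have [] := Hst n.
Qed.

(** Induction on [m]. Only [M] of the [k.+1] children are used, so the scale depends on [M] alone.
    Points below different children are separated at time [a k], points below the same child by
    induction. *)
Lemma separated_points (R : realType) (X : pmetricType R)
    (f : nat -> X -> X) (e : R) (a : nat -> nat) (s : nat -> seq (set X))
    (M m k : nat) (V : set X) :
  0 < e -> (forall k V, V \in s k -> V !=set0) ->
  (forall k, branches f e k.+1 (a k) (s k) (s k.+1)) ->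
  (M <= k.+1)%N -> V \in s k ->
  exists (T : finType) (x : T -> X),
    [/\ #|T| = (M ^ m)%N, forall t, V (x t) &
      forall t t', t != t' -> exists2 i, (i < k + m)%N &
        e / ((M.*2) ^ 2)%:R <=
          mdist (compn f (a i) (x t)) (compn f (a i) (x t'))].
Proof.
move=> e0 ns br; elim: m k V => [|m IH] k V Mk Vs.
  have [x Vx] := ns _ _ Vs.
  exists unit, (fun=> x); split => //; first by rewrite card_unit expn0.
have [p Hp] := br _ _ Vs.
(* The index type and its points form one object, so that a single [choice] selects all subtrees. *)
have sub (c : 'I_M) : exists (Tx : {T : finType & T -> X}),
    [/\ #|projT1 Tx| = (M ^ m)%N,
        forall t, V (projT2 Tx t) /\
          ring_around e p c (compn f (a k) (projT2 Tx t)) &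
        forall t t', t != t' -> exists2 i, (i < k + m.+1)%N &
          e / ((M.*2) ^ 2)%:R <=
          mdist (compn f (a i) (projT2 Tx t)) (compn f (a i) (projT2 Tx t'))].
  have [V' V's [V'V V'r]] := Hp c (leq_trans (ltn_ord c) Mk).
  have [T [x [cT xV' sep]]] := IH _ _ (leqW Mk) V's.
  exists (existT _ T x); split => //= [t|t t' tt'].
    by split; [apply: V'V|apply: V'r].
  by have [i] := sep _ _ tt'; rewrite addSnnS => ? ?; exists i.
have /choice[Tx HTx] := sub.
(* An index is a child with an index in its subtree: [M] subtrees of [M ^ m] points each. *)
exists {c : 'I_M & projT1 (Tx c)}, (fun t => projT2 (Tx (tag t)) (tagged t)); split.
- rewrite card_tagged sumnE big_map big_enum /=.
  rewrite (eq_bigr (fun=> M ^ m)%N); last by move=> c _; have [] := HTx c.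
  by rewrite sum_nat_const card_ord expnS.
- by move=> [c t]; have [_ /(_ t)[]] := HTx c.
move=> [c t] [c' t'] /=; have [cc'|cc'] := eqVneq c c'.
  case: _ / cc' t' => t' tt'.
  have [_ _ sep] := HTx c; apply: sep; apply: contraNneq tt' => -> //.
move=> _; exists k; first by rewrite -addSnnS ltn_addr.
have [_ /(_ t)[_ h] _] := HTx c; have [_ /(_ t')[_ h'] _] := HTx c'.
exact: ring_around_separated h h'.
Qed.

(** * Subcovers of joins and the lower bound on entropy *)

Lemma subcover_sizes_card (Z : Type) (W : set (set Z)) (T : finType)
    (F : T -> set Z) :
  (forall t, W (F t)) -> (forall z, exists t, F t z) ->
  subcover_sizes W #|T|.
Proof.
move=> WF cF; exists (fun i => F (enum_val i)); split => // z.
by have [t Ftz] := cF z; exists (enum_rank t); rewrite enum_rankK.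
Qed.

Lemma joinN_subcover (Z : Type) (F : nat -> set (set Z)) (n : nat) :
  (forall i, subcover_sizes (F i) !=set0) ->
  subcover_sizes (joinN F n) !=set0.
Proof.
move=> F0; elim: n => [|n [k [G [WG cG]]]].
  by exists 1%N, (fun=> setT); split => // z; exists ord0.
have [l [H [WH cH]]] := F0 n.
exists #|{: 'I_k * 'I_l}|.
apply: (@subcover_sizes_card _ _ _ (fun t => G t.1 `&` H t.2)).
  by move=> [i j] /=; exists (G i) => //; exists (H j).
by move=> z; have [i Gz] := cG z; have [j Hz] := cH z; exists (i, j).
Qed.

Lemma finite_open_cover_subcover (Z : Type) (op U : set (set Z)) :
  finite_open_cover op U -> subcover_sizes U !=set0.
Proof.
move=> [/finite_seqP[s Us] _ cU]; exists (size s), (fun i => nth set0 s i).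
split; first by move=> i; rewrite Us /= mem_nth.
move=> z; have : [set: Z] z by [].
rewrite -cU Us => -[A /= As Az].
by exists (Ordinal (etrans (index_mem _ _) As)); rewrite /= nth_index.
Qed.

Lemma subcover_sizes_preimg (Z : Type) (g : Z -> Z) (U : set (set Z)) :
  subcover_sizes U !=set0 -> subcover_sizes (preimg_family g U) !=set0.
Proof.
move=> [k [F [UF cF]]]; exists k, (fun i => g @^-1` F i); split.
  by move=> i; exists (F i).
by move=> z; exact: cF.
Qed.

Lemma joinN_sub (Z : Type) (F : nat -> set (set Z)) (n i : nat) (A : set Z) :
  joinN F n A -> (i < n)%N -> exists2 B, F i B & A `<=` B.
Proof.
elim: n A => // n IH _ [A FA [B FB <-]]; rewrite ltnS leq_eqVlt.
move=> /orP[/eqP ->|/(IH _ FA)[C FC AC]].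
  by exists B => //; exact: subIsetr.
by exists C => //; apply: subset_trans AC; exact: subIsetl.
Qed.

Section entropy_lower_bound.
Context {R : realType} {Z : Type} (op : set (set Z)) (g : nat -> Z -> Z).
Implicit Types (a : nat -> nat) (U : set (set Z)).

(** The analogue of an (n, eps)-separated set, phrased by a cover so as to apply to [X] and to
    measures alike. *)
Definition separated_by U a (n : nat) (T : finType) (x : T -> Z) : Prop :=
  forall t t', t != t' -> exists2 i, (i < n)%N &
    forall A, U A -> ~ (A (compn g (a i) (x t)) /\ A (compn g (a i) (x t'))).

(** A member of the join lies in one preimage for each index below [n], so it contains at most one
    of the separated points. Assigning to each point a member of the subcover around it is thus
    injective. *)
Lemma covN_ge_card U a n (T : finType) (x : T -> Z) :
  finite_open_cover op U -> separated_by U a n x ->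
  #|T|%:R <= covN (R := R) (joinN (fun i => preimg_family (compn g (a i)) U) n).
Proof.
move=> cU sep; apply: lb_le_inf.
  (* A lower bound passes to [inf] only for a nonempty set, so some finite subcover has to be
     exhibited. *)
  have [|k Hk] := @joinN_subcover _ (fun i => preimg_family (compn g (a i)) U) n.
    by move=> i; apply: subcover_sizes_preimg; exact: finite_open_cover_subcover cU.
  by exists k%:R, k.
move=> _ [k [F [WF cF]] <-]; rewrite ler_nat.
have [phi Hphi] := choice (fun t => cF (x t)).
suff : injective phi by move=> /leq_card; rewrite card_ord.
move=> t t' tt'; apply/eqP; apply: contrapT => /negP /sep[i iN].
have [_ [A UA <-] FA] := joinN_sub (WF (phi t)) iN.
move=> /(_ A UA); apply; split; first exact: FA.
by apply: FA; rewrite tt'; exact: Hphi.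
Qed.

Lemma limn_esup_ge (u : (\bar R)^nat) (c : \bar R) (N : nat) :
  (forall n, (N <= n)%N -> (c <= u n)%E) -> (c <= limn_esup u)%E.
Proof.
move=> cu; rewrite limn_esup_lim; apply: lime_ge; first exact: is_cvg_esups.
near=> n; apply: le_trans (cu (maxn N n) (leq_maxl _ _)) _.
by apply: ereal_sup_ubound; exists (maxn N n) => //=; exact: leq_maxr.
Unshelve. all: by end_near. Qed.

Lemma limn_esup_covN_ge U a (M K : nat) :
  finite_open_cover op U -> (0 < M)%N ->
  (forall m, exists (T : finType) (x : T -> Z),
    #|T| = (M ^ m)%N /\ separated_by U a (K + m) x) ->
  ((ln M%:R / 2)%:E <= limn_esup (fun n : nat =>
    (ln (covN (R := R) (joinN (fun i => preimg_family (compn g (a i)) U) n))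
      / n%:R)%:E))%E.
Proof.
(* For [n > 2K] the exponent [n - K] is at least n/2, which is where the factor 1/2 comes from; also
   [n] is positive. *)
move=> cU M0 H; apply: (@limn_esup_ge _ _ (K.*2.+1)) => n Kn; rewrite lee_fin.
have n0 : 0 < n%:R :> R by rewrite ltr0n; lia.
have [T [x [cT]]] := H (n - K)%N.
rewrite subnKC; last lia.
move=> /(covN_ge_card cU); rewrite cT => le_cov.
rewrite ler_pdivlMr//.
have Mm0 : 0 < (M ^ (n - K))%:R :> R by rewrite ltr0n expn_gt0 M0.
apply: (@le_trans _ _ (ln ((M ^ (n - K))%:R))); last first.
  by rewrite ler_ln ?posrE// (lt_le_trans Mm0).
rewrite natrX lnXn ?ltr0n// -[leRHS]mulr_natr -mulrA ler_wpM2l//.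
  by rewrite ln_ge0// ler1n.
rewrite ler_pdivrMl// -natrM ler_nat; lia.
Qed.

End entropy_lower_bound.

Lemma natr_ln_large (R : realType) (r : R) : exists2 M : nat,
  (0 < M)%N & r <= ln M%:R / 2.
Proof.
exists (Num.truncn (expR (r * 2))).+1 => //.
rewrite ler_pdivlMr// -[leLHS]expRK ler_ln ?posrE ?expR_gt0 ?ltr0n//.
by apply/ltW; rewrite truncnS_gt.
Qed.

(** * Finite covers of [X] by small sets *)

Lemma finite_centers (R : realType) (X : pmetricType R) (e : R) :
  compact [set: X] -> 0 < e ->
  exists s : seq X, forall x, exists2 p, p \in s & mdist p x < e.
Proof.
move=> cX e0; move: cX; rewrite compact_cover.
move=> /(_ X setT (fun p => mdist p @^-1` [set y | y < e])).
move=> [p _||D _ cD].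
- by apply: open_comp; [move=> y _; exact: continuous_mdist|exact: open_lt].
- by move=> x _; exists x => //=; rewrite mdistxx.
have /finite_seqP[s Ds] : finite_set [set` D] by exact: finite_fset.
exists s => x; have [p /= pD px] := cD x I; exists p => //.
by have : [set` D] p by []; rewrite Ds.
Qed.

Lemma mdist_lt_cover (R : realType) (X : pmetricType R) (e : R) :
  compact [set: X] -> 0 < e ->
  exists2 U : set (set X), finite_open_cover (@open X) U &
    forall A, U A -> forall x y, A x -> A y -> mdist x y < e.
Proof.
move=> cX e0; have e20 : 0 < e / 2 by rewrite divr_gt0.
have [s Hs] := finite_centers cX e20.
exists [set mdist p @^-1` [set y | y < e / 2] | p in [set` s]].
  split.
  - by apply: finite_image; exact: finite_seq.
  - move=> _ [p _ <-]; apply: open_comp; last exact: open_lt.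
    by move=> y _; exact: continuous_mdist.
  - rewrite -subTset => x _; have [p ps px] := Hs x.
    by exists (mdist p @^-1` [set y | y < e / 2]) => //; exists p.
move=> _ [p _ <-] x y /= px py.
by have := metric_triangle x p y; rewrite (metric_sym x p); lra.
Qed.

(** * Borel measures, Dirac masses and weakly open covers *)

Lemma borel_measurable_continuous (R : realType) (X : pmetricType R)
    (g : X -> X) :
  continuous g -> measurable_fun [set: Borel X] (g : Borel X -> Borel X).
Proof.
move=> cg; apply: (@measurability _ _ (Borel X) (Borel X) setT g (@open X) erefl).
move=> _ [B oB <-].
rewrite setTI; apply: sub_sigma_algebra.
by apply: open_comp => // x _; exact: cg.
Qed.

Lemma borel_measurable_real (R : realType) (X : pmetricType R) (g : X -> R) :
  continuous g -> measurable_fun [set: Borel X] (g : Borel X -> R).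
Proof.
move=> cg; apply: (measurability (@measurable_realfun.RGenOInfty.G R) (measurable_realfun.RGenOInfty.measurableE R)).
move=> _ [_ [r ->] <-]; rewrite setTI; apply: sub_sigma_algebra.
by apply: open_comp => [x _|]; [exact: cg|exact: interval_open].
Qed.

(** Pushing a Dirac mass forward moves its point; measurability of [f n] rules out the fallback
    branch of [hatmap]. Equality set by set suffices to rewrite integrals. *)
Lemma compn_hatseq_dirac (R : realType) (X : pmetricType R)
    (f : nat -> X -> X) (n : nat) (x : X) (B : set (Borel X)) :
  (forall k, continuous (f k)) ->
  (compn (hatseq f) n (dirac (x : Borel X) : probM X)) B
    = dirac (compn f n x : Borel X) B.
Proof.
move=> cf; elim: n B => //= n IH B.
rewrite /hatseq /hatmap; case: pselect => [mf|]; last first.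
  by move=> /(_ (borel_measurable_continuous (cf n))).
by rewrite /= /distribution /pushforward IH !diracE.
Qed.

Definition bump {R : realType} {X : pmetricType R} (e : R) (p : X) (x : X) : R :=
  Num.max 0 (e - mdist p x).

Lemma bump_gt0 (R : realType) (X : pmetricType R) (e : R) (p x : X) :
  (0 < bump e p x) = (mdist p x < e).
Proof. by rewrite /bump lt_max ltxx subr_gt0. Qed.

Lemma bump_ge0 (R : realType) (X : pmetricType R) (e : R) (p x : X) :
  0 <= bump e p x.
Proof. by rewrite /bump le_max lexx. Qed.

Lemma continuous_bump (R : realType) (X : pmetricType R) (e : R) (p : X) :
  continuous (bump e p).
Proof.
move=> x; apply: (@continuous_max _ _ (fun=> 0) (fun x => e - mdist p x)).
  exact: cvg_cst.
by apply: cvgB; [exact: cvg_cst|exact: continuous_mdist].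
Qed.

Lemma measurable_bump (R : realType) (X : pmetricType R) (e : R) (p : X) :
  measurable_fun [set: Borel X] (bump e p : Borel X -> R).
Proof.
by apply: (@borel_measurable_real _ X (bump e p)); exact: continuous_bump.
Qed.

Lemma integrable_bump (R : realType) (X : pmetricType R) (mu : probM X) (e : R)
    (p : X) :
  0 < e -> mu.-integrable setT (EFin \o (bump e p : Borel X -> R)).
Proof.
move=> e0; apply: measurable_bounded_integrable => //.
- by apply: (le_lt_trans (probability_le1 mu _)) => //; rewrite ltry.
- exact: measurable_bump.
exists e; split => [|M eM x _ /=]; first exact: num_real.
rewrite ger0_norm ?bump_ge0// /bump ge_max.
have d0 := mdist_ge0 p x; by apply/andP; split; lra.
Qed.

(** These are the measures charging the ball of radius [e] about [p]; the integral of a continuous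
    function makes weak openness visible. *)
Definition bump_open {R : realType} {X : pmetricType R} (e : R) (p : X) :
  set (probM X) := [set mu | 0 < Rintegral mu setT (bump e p : Borel X -> R)].

Lemma weak_open_bump (R : realType) (X : pmetricType R) (e : R) (p : X) :
  weak_open (bump_open e p).
Proof.
move=> mu; rewrite /bump_open /= => mu0.
(* With the mean itself as tolerance, nearby measures keep a positive mean. *)
exists 1%N, (fun=> bump e p), (Rintegral mu setT (bump e p : Borel X -> R)).
split => //; first by move=> _; exact: continuous_bump.
by move=> nu /= /(_ ord0); rewrite ltr_distl subrr => /andP[].
Qed.

(* The sum of the bumps is bounded below, so some bump has positive mean. *)
Lemma bump_open_cover (R : realType) (X : pmetricType R) (e : R) (s : seq X) :
  0 < e -> (forall x, exists2 p, p \in s & mdist p x < e / 2) ->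
  finite_open_cover (@weak_open R X) [set bump_open e p | p in [set` s]].
Proof.
move=> e0 Hs; split.
- by apply: finite_image; exact: finite_seq.
- by move=> _ [p _ <-]; exact: weak_open_bump.
rewrite -subTset => mu _; apply: contrapT => Nmu.
have int0 p : p \in s -> (\int[mu]_(x in setT) (bump e p x)%:E = 0)%E.
  move=> ps; have ib := integrable_bump mu p e0.
  rewrite -[LHS]fineK; last exact: integrable_fin_num.
  congr (_%:E); apply/eqP; rewrite eq_le Rintegral_ge0 ?andbT; last first.
    by move=> x _; exact: bump_ge0.
  rewrite leNgt; apply/negP => mup; apply: Nmu.
  by exists (bump_open e p) => //; exists p.
have : ((e / 2)%:E <= \int[mu]_(x in setT) \sum_(p <- s) (bump e p x)%:E)%E.
  have -> : (e / 2)%:E = (\int[mu]_(x in setT) (e / 2)%:E)%E.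
    by rewrite integral_cst// [X in (_ * X)%E]probability_setT mule1.
  apply: ge0_le_integral => //.
  - by move=> x _; rewrite lee_fin divr_ge0// ltW.
  - apply: emeasurable_sum => p.
    by apply/measurable_realfun.measurable_EFinP; exact: measurable_bump.
  (* A centre within [e / 2] of [x] has a bump of height above [e / 2] there, and the other bumps
     are nonnegative. *)
  - move=> x _; have [p ps px] := Hs x.
    rewrite (perm_big _ (perm_to_rem ps)) big_cons sumEFin lee_fin.
    apply: ler_wpDr; first by apply: sumr_ge0 => q _; exact: bump_ge0.
    by rewrite /bump le_max; apply/orP; right; lra.
rewrite ge0_integral_sum//; last 2 first.
- move=> p.
  by apply/measurable_realfun.measurable_EFinP; exact: measurable_bump.
- by move=> p x _; rewrite lee_fin bump_ge0.
rewrite big_seq big1; last by move=> p; exact: int0.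
by rewrite lee_fin leNgt divr_gt0.
Qed.

(** Integrating against a Dirac mass evaluates the bump at the moved point; this transfers
    separation from [X] to measures. *)
Lemma bump_open_dirac (R : realType) (X : pmetricType R) (f : nat -> X -> X)
    (n : nat) (x : X) (e : R) (p : X) :
  (forall k, continuous (f k)) ->
  bump_open e p (compn (hatseq f) n (dirac (x : Borel X) : probM X)) ->
  mdist p (compn f n x) < e.
Proof.
move=> cf; rewrite /bump_open /= /Rintegral.
rewrite (@eq_measure_integral _ _ _ _ (dirac (compn f n x : Borel X))); last first.
  by move=> A _ _; exact: compn_hatseq_dirac.
rewrite integral_dirac//; last first.
  by apply/measurable_realfun.measurable_EFinP; exact: measurable_bump.
by rewrite diracT mul1e /= bump_gt0.
Qed.

(** * Infinite entropy on [X] and on measures *)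

(** Both [U] and [K] may depend on [M]: the entropy is a supremum over covers, and each [M]
    contributes at least (ln M)/2. *)
Lemma seq_entropy_along_infty (R : realType) (Z : Type) (op : set (set Z))
    (g : nat -> Z -> Z) (a : nat -> nat) :
  (forall M, (0 < M)%N -> exists2 U, finite_open_cover op U & exists K, forall m,
    exists (T : finType) (x : T -> Z),
      #|T| = (M ^ m)%N /\ separated_by g U a (K + m) x) ->
  seq_entropy_along (R := R) op g a = +oo%E.
Proof.
move=> H; apply: eq_infty => r; have [M M0 rM] := natr_ln_large r.
have [U cU [K HU]] := H M M0.
apply: (@le_trans _ _ (ln (M%:R : R) / 2)%:E); first by rewrite lee_fin.
apply: le_trans (limn_esup_covN_ge cU M0 HU) _.
by apply: ereal_sup_ubound; exists U.
Qed.

Unset Implicit Arguments.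
Local Open Scope ereal_scope.

Theorem theorem6p2 (R : realType) (X : pmetricType R) (f : nat -> X -> X) :
  compact [set: X] ->
  locally_connected X ->
  (forall n, continuous (f n)) ->
  (forall y : X, exists x : X, f 0%N x = y) ->
  multi_sensitive f ->
  exists a : nat -> nat,
    [/\ strictly_increasing a,
        seq_entropy_along (R := R) (@open X) f a = +oo,
        seq_entropy_along (R := R) (@weak_open R X) (hatseq f) a = +oo,
        seq_entropy (R := R) (@weak_open R X) (hatseq f) = +oo &
        seq_entropy (R := R) (@open X) f = +oo].
Proof.
move=> cX lcX cf _ msf.
have [e [a [s [e0 inca s0 ns br]]]] := branching_sequence lcX cf msf.
have pts M : exists K, forall m, exists (T : finType) (x : T -> X),
    #|T| = (M ^ m)%N /\ forall t t', t != t' -> exists2 i, (i < K + m)%N &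
      (e / ((M.*2) ^ 2)%:R <=
        mdist (compn f (a i) (x t)) (compn f (a i) (x t')))%R.
  (* The tree starts at stage [M], where [M.+1] branches are available. *)
  exists M => m; have [V Vs] := s0 M.
  have [T [x [cT _ sep]]] := separated_points m e0 ns br (leqnSn M) Vs.
  by exists T, x.
have sep0 M : (0 < M)%N -> (0 < e / ((M.*2) ^ 2)%:R)%R.
  by move=> M0; rewrite divr_gt0// ltr0n expn_gt0 double_gt0 M0.
have hf : seq_entropy_along (R := R) (@open X) f a = +oo.
  apply: seq_entropy_along_infty => M M0.
  have [U cU smallU] := mdist_lt_cover cX (sep0 _ M0).
  exists U => //; have [K HK] := pts M; exists K => m.
  have [T [x [cT sep]]] := HK m; exists T, x; split => // t t' /sep[i iK far].
  exists i => // A UA [Ax Ax'].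
  by have := smallU _ UA _ _ Ax Ax'; rewrite ltNge far.
have hhat : seq_entropy_along (R := R) (@weak_open R X) (hatseq f) a = +oo.
  apply: seq_entropy_along_infty => M M0.
  (* Half the separation scale: two points within it of a common centre are closer than the scale.
     The centres are then taken [d0 / 2]-dense, as the bump cover requires. *)
  have d0 := divr_gt0 (sep0 _ M0) (ltr0Sn R 1).
  have [c Hc] := finite_centers cX (divr_gt0 d0 (ltr0Sn R 1)).
  eexists; first exact: bump_open_cover d0 Hc.
  have [K HK] := pts M; exists K => m.
  have [T [x [cT sep]]] := HK m.
  exists T, (fun t => dirac (x t : Borel X) : probM X); split => // t t' /sep[i iK far].
  exists i => // _ [p _ <-] [/(bump_open_dirac cf) px /(bump_open_dirac cf) px'].
  have := metric_triangle (compn f (a i) (x t)) p (compn f (a i) (x t')).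
  by rewrite (metric_sym _ p); lra.
exists a; split => //.
- apply/eqP; rewrite -leye_eq -hhat.
  by apply: ereal_sup_ubound; exists a.
- apply/eqP; rewrite -leye_eq -hf.
  by apply: ereal_sup_ubound; exists a.
Qed.
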